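(* Let $\mathfrak{g}$ be a Leibniz algebra over a field $\mathbb{K}$. Then there is an isomorphism $$HL_2(\mathfrak{g}) \cong \operatorname{Ker}\big(\theta_{\mathfrak{g},\mathfrak{g}}\colon \mathfrak{g}\curlywedge\mathfrak{g}\to\mathfrak{g}\big).$$
   Context: $\mathbb{K}$ is a field; all vector spaces and algebras are over $\mathbb{K}$, and $\otimes=\otimes_{\mathbb{K}}$. A Leibniz algebra is a vector space $\mathfrak{g}$ with a bilinear bracket satisfying $[x,[y,z]]=[[x,y],z]-[[x,z],y]$. Homomorphisms are linear maps preserving the bracket. Leibniz homology: $HL_n(\mathfrak{g})$ is the $n$-th homology of the complex $CL_*(\mathfrak{g})$ with $CL_n(\mathfrak{g})=\mathfrak{g}^{\otimes n}$ ($CL_0=\mathbb{K}$), $d(x)=0$ for $x\in\mathfrak{g}$, and for $n>1$ $$d(x_1\otimes\cdots\otimes x_n)=\sum_{1\le i<j\le n}(-1)^j\, x_1\otimes\cdots\otimes x_{i-1}\otimes[x_i,x_j]\otimes x_{i+1}\otimes\cdots\otimes\widehat{x_j}\otimes\cdots\otimes x_n .$$ Non-abelian tensor and exterior product of ideals: let $\mathfrak{a},\mathfrak{b}$ be two-sided ideals of a Leibniz algebra $\mathfrak{g}$ (possibly $\mathfrak{a}=\mathfrak{b}=\mathfrak{g}$). $\mathfrak{a}\star\mathfrak{b}$ is the Leibniz algebra generated by two formally distinct families of symbols $a*_1b$ and $b*_2a$ ($a\in\mathfrak{a}$, $b\in\mathfrak{b}$), both $\mathbb{K}$-bilinear in their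 arguments, subject to, for all $a,a'\in\mathfrak{a}$, $b,b'\in\mathfrak{b}$: $a*_1[b,b']=[a,b]*_1b'-[a,b']*_1b$; $b*_2[a,a']=[b,a]*_2a'-[b,a']*_2a$; $[a,a']*_1b=[a,b]*_2a'-a*_1[b,a']$; $[b,b']*_2a=[b,a]*_1b'-b*_2[a,b']$; $a*_1[a',b]=-a*_1[b,a']$; $b*_2[b',a]=-b*_2[a,b']$; $[a,b]*_1[a',b']=[a*_1b,\,a'*_1b']=[a,b]*_2[a',b']$; $[b,a]*_1[b',a']=[b*_2a,\,b'*_2a']=[b,a]*_2[b',a']$; $[a,b]*_1[b',a']=[a*_1b,\,b'*_2a']=[a,b]*_2[b',a']$; $[b,a]*_1[a',b']=[b*_2a,\,a'*_1b']=[b,a]*_2[a',b']$. The non-abelian exterior product $\mathfrak{a}\curlywedge\mathfrak{b}$ is the quotient of $\mathfrak{a}\star\mathfrak{b}$ by the (central) ideal spanned by all $c*_1c'-c*_2c'$ with $c,c'\in\mathfrak{a}\cap\mathfrak{b}$. The classes of $a*_1b$ and $b*_2a$ are written $a\curlywedge b$ and $b\curlywedge a$. The Leibniz homomorphism $\theta_{\mathfrak{a},\mathfrak{b}}\colon\mathfrak{a}\curlywedge\mathfrak{b}\to\mathfrak{a}\cap\mathfrak{b}$ is given by $a\curlywedge b\mapsto[a,b]$, $b\curlywedge a\mapsto[b,a]$. *)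

(* Defs.v *)
From HB Require Import structures.
From mathcomp Require Import freeg.
From mathcomp Require Import all_boot all_algebra.
From mathcomp Require Import boolp.

Set Implicit Arguments.
Unset Strict Implicit.
Unset Printing Implicit Defensive.

Import GRing.Theory.
Local Open Scope ring_scope.
Local Open Scope quotient_scope.

Reserved Notation "⁅ x , y ⁆" (at level 0, x, y at level 99, format "⁅ x ,  y ⁆").

Section SubModType.
Variables (K : fieldType) (V : lmodType K) (S : submodClosed V).

Record subm : Type := Subm { subm_val : V; subm_valP : subm_val \in S }.

HB.instance Definition _ := [isSub for subm_val].
HB.instance Definition _ := [Choice of subm by <:].
HB.instance Definition _ := [SubChoice_isSubLmodule of subm by <:].

End SubModType.

Section QuotModType.
Variables (K : fieldType) (V : lmodType K) (S : submodClosed V).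

Definition submod_pred : {pred V} := fun x => x \in S.
Lemma submod_pred_closed : zmod_closed submod_pred.
Proof.
split=> [|x y hx hy]; first exact: rpred0.
by rewrite /in_mem /= /submod_pred -scaleN1r rpredD // rpredZ.
Qed.
HB.instance Definition _ := GRing.isZmodClosed.Build V submod_pred submod_pred_closed.

Definition quotm : Type := Quotient.quot submod_pred.
HB.instance Definition _ := GRing.Zmodule.on quotm.

Definition qpi (x : V) : quotm := \pi_(Quotient.quot submod_pred) x.
Definition qrepr (q : quotm) : V := @repr _ (Quotient.quot submod_pred) q.

Lemma qreprK : cancel qrepr qpi.
Proof. by move=> q; rewrite /qpi reprK. Qed.

Lemma eq_qpi x y : (qpi x = qpi y) <-> (x - y \in S).
Proof.
have -> : (x - y \in S) = (qpi x == qpi y) := Quotient.idealrBE submod_pred x y.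
by split=> /eqP.
Qed.

Lemma qrepr_qpi x : qrepr (qpi x) - x \in S.
Proof. by apply/eq_qpi; rewrite qreprK. Qed.

Lemma qpiB x y : qpi (x - y) = qpi x - qpi y.
Proof. by rewrite /qpi; exact: raddfB. Qed.
HB.instance Definition _ := GRing.isZmodMorphism.Build V quotm qpi qpiB.

Definition qscale (c : K) (q : quotm) : quotm := qpi (c *: qrepr q).

Lemma qscale_qpi c x : qscale c (qpi x) = qpi (c *: x).
Proof. by apply/eq_qpi; rewrite -scalerBr rpredZ // qrepr_qpi. Qed.

Lemma qscaleA a b q : qscale a (qscale b q) = qscale (a * b) q.
Proof. by rewrite -[q]qreprK !qscale_qpi scalerA. Qed.
Lemma qscale1 : left_id 1 qscale.
Proof. by move=> q; rewrite -[q]qreprK qscale_qpi scale1r. Qed.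
Lemma qscaleDr : right_distributive qscale +%R.
Proof.
by move=> c p q; rewrite -[p]qreprK -[q]qreprK -raddfD !qscale_qpi scalerDr raddfD.
Qed.
Lemma qscaleDl q : {morph qscale^~ q : a b / a + b}.
Proof. by move=> a b; rewrite -[q]qreprK !qscale_qpi scalerDl raddfD. Qed.

HB.instance Definition _ :=
  GRing.Zmodule_isLmodule.Build K quotm qscaleA qscale1 qscaleDr qscaleDl.

Lemma qpiZ : scalable qpi.
Proof. by move=> c x; rewrite -qscale_qpi. Qed.
HB.instance Definition _ := GRing.isScalable.Build K V quotm *:%R qpi qpiZ.

Lemma qpi_eq0 x : (qpi x = 0) <-> (x \in S).
Proof. by rewrite -(linear0 qpi) eq_qpi subr0. Qed.

Section Lift.
Variables (W : lmodType K) (f : {linear V -> W}).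
Hypothesis f0 : forall x, x \in S -> f x = 0.

Definition qlift (q : quotm) : W := f (qrepr q).

Lemma qlift_qpi x : qlift (qpi x) = f x.
Proof. by apply/eqP; rewrite /qlift -subr_eq0 -linearB f0 // qrepr_qpi. Qed.

Lemma qlift_linear : linear qlift.
Proof.
move=> c p q; rewrite -[p]qreprK -[q]qreprK -linearZ -linearD !qlift_qpi.
by rewrite linearP.
Qed.
End Lift.

End QuotModType.

Section Span.
Variables (K : fieldType) (V : lmodType K) (R : V -> Prop).

Inductive in_span : V -> Prop :=
| span_gen x : R x -> in_span x
| span_zero : in_span 0
| span_lin c x y : in_span x -> in_span y -> in_span (c *: x + y).

Definition span : {pred V} := fun x => `[< in_span x >].

Lemma span_closed : subsemimod_closed span.
Proof.
split; first split.
- by apply/asboolP; exact: span_zero.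
- move=> x y /asboolP hx /asboolP hy; apply/asboolP.
  by rewrite -[x]scale1r; exact: span_lin.
- move=> c x /asboolP hx; apply/asboolP.
  by rewrite -[_ *: _]addr0; apply: span_lin => //; exact: span_zero.
Qed.
HB.instance Definition _ := GRing.isSubmodClosed.Build K V span span_closed.

Lemma span_sub (W : lmodType K) (f : {linear V -> W}) :
  (forall x, R x -> f x = 0) -> forall x, x \in span -> f x = 0.
Proof.
move=> fR x /asboolP; elim=> [y|//|c y z _ fy _ fz]; [exact: fR|exact: linear0|].
by rewrite linearP fy fz scaler0 addr0.
Qed.
End Span.

Section KerIm.
Variables (K : fieldType) (U V : lmodType K) (f : {linear U -> V}).

Definition kerl : {pred U} := fun x => f x == 0.
Definition iml : {pred V} := fun y => `[< exists x, f x = y >].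

Lemma kerl_closed : subsemimod_closed kerl.
Proof.
split; first split.
- by rewrite /in_mem /= /kerl linear0.
- by move=> x y /eqP hx /eqP hy; apply/eqP; rewrite linearD hx hy addr0.
- by move=> c x /eqP hx; apply/eqP; rewrite linearZ /= hx scaler0.
Qed.
HB.instance Definition _ := GRing.isSubmodClosed.Build K U kerl kerl_closed.

Lemma iml_closed : subsemimod_closed iml.
Proof.
split; first split.
- by apply/asboolP; exists 0; rewrite linear0.
- move=> x y /asboolP[u <-] /asboolP[v <-]; apply/asboolP.
  by exists (u + v); rewrite linearD.
- by move=> c x /asboolP[u <-]; apply/asboolP; exists (c *: u); rewrite linearZ.
Qed.
HB.instance Definition _ := GRing.isSubmodClosed.Build K V iml iml_closed.
End KerIm.

(** [ker g / (im f ∩ ker g)]; this is [ker g / im f] when [g \o f = 0]. *)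
Section Homology.
Variables (K : fieldType) (A B C : lmodType K).
Variables (f : {linear A -> B}) (g : {linear B -> C}).

Definition boundaries : {pred subm (kerl g)} := fun z => val z \in iml f.

Lemma boundaries_closed : subsemimod_closed boundaries.
Proof.
split; first split.
- by rewrite /in_mem /= /boundaries linear0 rpred0.
- by move=> x y hx hy; rewrite /in_mem /= /boundaries linearD rpredD.
- by move=> c x hx; rewrite /in_mem /= /boundaries linearZ rpredZ.
Qed.
HB.instance Definition _ :=
  GRing.isSubmodClosed.Build K (subm (kerl g)) boundaries boundaries_closed.

Definition homology : lmodType K := quotm boundaries.
End Homology.

Section FreeModule.
Variables (K : fieldType) (X : choiceType).

Definition freeMod : Type := {freeg X / K}.
HB.instance Definition _ := GRing.Lmodule.on freeMod.

Definition fm (x : X) : freeMod := << x >>.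

Lemma fmU c x : << c *g x >> = c *: fm x.
Proof. by apply/eqP/freeg_eqP => y; rewrite coeffZ !coeffU mul1r. Qed.

Lemma fm_sumE (u : freeMod) : u = \sum_(x <- dom u) coeff x u *: fm x.
Proof.
by rewrite -[LHS]freeg_sumE; apply: eq_bigr => x _; rewrite fmU.
Qed.

Lemma fm_ind (P : freeMod -> Prop) :
  P 0 -> (forall c x u, P u -> P (c *: fm x + u)) -> forall u, P u.
Proof.
move=> P0 PD u; rewrite [u]fm_sumE; elim: (dom u) => [|x s IH].
  by rewrite big_nil.
by rewrite big_cons; exact: PD.
Qed.

Section Lift.
Variables (W : lmodType K) (f : X -> W).

Definition fmlift (u : freeMod) : W := fglift f u.

Lemma fmliftB : zmod_morphism fmlift.
Proof. exact: freeg.lift_is_additive. Qed.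
HB.instance Definition _ := GRing.isZmodMorphism.Build freeMod W fmlift fmliftB.

Lemma fmlift_fm x : fmlift (fm x) = f x.
Proof. by rewrite /fmlift /fm liftU scale1r. Qed.

Lemma fmliftZ : scalable fmlift.
Proof.
move=> c u; elim/fm_ind: u => [|k x u IH]; first by rewrite scaler0 raddf0 scaler0.
have fS a : fmlift (a *: fm x) = a *: f x by rewrite -fmU /fmlift liftU.
have fD a b : fmlift (a + b) = fmlift a + fmlift b by exact: raddfD.
by rewrite scalerDr scalerA !fD IH !fS scalerDr scalerA.
Qed.
HB.instance Definition _ := GRing.isScalable.Build K freeMod W *:%R fmlift fmliftZ.

Lemma fmlift_linear : linear fmlift. Proof. exact: linearP. Qed.
End Lift.
End FreeModule.

HB.mixin Record hasBracket (K : fieldType) V of GRing.Lmodule K V := {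
  br : V -> V -> V;
  br_linearl : forall y : V, linear (fun x => br x y);
  br_linearr : forall x : V, linear (br x)
}.

#[short(type="brAlgType")]
HB.structure Definition BrAlgebra (K : fieldType) :=
  {V of hasBracket K V & GRing.Lmodule K V}.

Notation "⁅ x , y ⁆" := (br x y) : ring_scope.

HB.mixin Record isLeibniz (K : fieldType) V of BrAlgebra K V := {
  leibniz : forall x y z : V, ⁅x, ⁅y, z⁆⁆ = ⁅⁅x, y⁆, z⁆ - ⁅⁅x, z⁆, y⁆
}.

#[short(type="leibnizType")]
HB.structure Definition Leibniz (K : fieldType) :=
  {V of isLeibniz K V & BrAlgebra K V}.

Section BracketTheory.
Variables (K : fieldType) (A : brAlgType K).

HB.instance Definition _ (x : A) :=
  GRing.isLinear.Build K A A *:%R (br x) (br_linearr x).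

Definition brl (y x : A) : A := ⁅x, y⁆.
HB.instance Definition _ (y : A) :=
  GRing.isLinear.Build K A A *:%R (brl y) (br_linearl y).

Lemma brDl x x' y : ⁅x + x', y⁆ = ⁅x, y⁆ + ⁅x', y⁆ :> A.
Proof. exact: (linearD (brl y)). Qed.
Lemma brBl x x' y : ⁅x - x', y⁆ = ⁅x, y⁆ - ⁅x', y⁆ :> A.
Proof. exact: (linearB (brl y)). Qed.
Lemma brNl x y : ⁅- x, y⁆ = - ⁅x, y⁆ :> A.
Proof. exact: (linearN (brl y)). Qed.
Lemma brZl c x y : ⁅c *: x, y⁆ = c *: ⁅x, y⁆ :> A.
Proof. exact: (linearZZ (brl y)). Qed.
Lemma br0l y : ⁅0, y⁆ = 0 :> A.
Proof. exact: (linear0 (brl y)). Qed.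
End BracketTheory.

HB.mixin Record isBracketIdeal (K : fieldType) (A : brAlgType K) (S : {pred A}) := {
  ideal_brr : forall x y : A, x \in S -> ⁅x, y⁆ \in S;
  ideal_brl : forall x y : A, y \in S -> ⁅x, y⁆ \in S
}.

#[short(type="brIdeal")]
HB.structure Definition BrIdeal (K : fieldType) (A : brAlgType K) :=
  {S of isBracketIdeal K A S & GRing.AddClosed A S & GRing.isScaleClosed K A S}.

Section IdealAction.
Variables (K : fieldType) (A : brAlgType K) (I : brIdeal A).

Definition ibrr (x : subm I) (y : A) : subm I :=
  Subm (ideal_brr (val x) y (valP x)).
Definition ibrl (y : A) (x : subm I) : subm I :=
  Subm (ideal_brl y (val x) (valP x)).
End IdealAction.

Section FullIdeal.
Variables (K : fieldType) (A : brAlgType K).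

Definition full_ideal : {pred A} := fun=> true.

Lemma full_ideal_closed : subsemimod_closed full_ideal. Proof. by []. Qed.
HB.instance Definition _ :=
  GRing.isSubmodClosed.Build K A full_ideal full_ideal_closed.
HB.instance Definition _ :=
  isBracketIdeal.Build K A full_ideal (fun _ _ _ => isT) (fun _ _ _ => isT).
End FullIdeal.
Arguments full_ideal {K} A.

Section GeneratedIdeal.
Variables (K : fieldType) (A : brAlgType K) (R : A -> A -> Prop).

Inductive in_gen_ideal : A -> Prop :=
| gi_gen u v : R u v -> in_gen_ideal (u - v)
| gi_zero : in_gen_ideal 0
| gi_lin c x y : in_gen_ideal x -> in_gen_ideal y -> in_gen_ideal (c *: x + y)
| gi_brr x y : in_gen_ideal x -> in_gen_ideal ⁅x, y⁆
| gi_brl x y : in_gen_ideal y -> in_gen_ideal ⁅x, y⁆.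

Definition gen_ideal : {pred A} := fun x => `[< in_gen_ideal x >].

Lemma gen_ideal_closed : subsemimod_closed gen_ideal.
Proof.
split; first split.
- by apply/asboolP; exact: gi_zero.
- move=> x y /asboolP hx /asboolP hy; apply/asboolP.
  by rewrite -[x]scale1r; exact: gi_lin.
- move=> c x /asboolP hx; apply/asboolP.
  by rewrite -[_ *: _]addr0; apply: gi_lin => //; exact: gi_zero.
Qed.
HB.instance Definition _ := GRing.isSubmodClosed.Build K A gen_ideal gen_ideal_closed.

Lemma gen_ideal_brr x y : x \in gen_ideal -> ⁅x, y⁆ \in gen_ideal.
Proof. by move=> /asboolP hx; apply/asboolP; exact: gi_brr. Qed.
Lemma gen_ideal_brl x y : y \in gen_ideal -> ⁅x, y⁆ \in gen_ideal.
Proof. by move=> /asboolP hx; apply/asboolP; exact: gi_brl. Qed.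
HB.instance Definition _ :=
  isBracketIdeal.Build K A gen_ideal gen_ideal_brr gen_ideal_brl.

Lemma gen_ideal_sub (B : brAlgType K) (f : {linear A -> B}) :
    {morph f : x y / ⁅x, y⁆} -> (forall u v, R u v -> f u = f v) ->
  forall x, x \in gen_ideal -> f x = 0.
Proof.
move=> fbr fR x /asboolP; elim=> [u v /fR e||c y z _ fy _ fz|y z _ fy|y z _ fz].
- by rewrite linearB e subrr.
- exact: linear0.
- by rewrite linearP fy fz scaler0 addr0.
- by rewrite fbr fy br0l.
- by rewrite fbr fz linear0.
Qed.
End GeneratedIdeal.

Section QuotientAlgebra.
Variables (K : fieldType) (A : brAlgType K) (I : brIdeal A).

Definition qbr (p q : quotm I) : quotm I := qpi I ⁅qrepr p, qrepr q⁆.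

Lemma qbr_qpi x y : qbr (qpi I x) (qpi I y) = qpi I ⁅x, y⁆.
Proof.
apply/eq_qpi; set x' := qrepr _; set y' := qrepr _.
rewrite -[⁅x', y'⁆](subrK ⁅x', y⁆) -addrA rpredD //.
  by rewrite -linearB; apply: ideal_brl; exact: qrepr_qpi.
by rewrite -brBl; apply: ideal_brr; exact: qrepr_qpi.
Qed.

Lemma qbr_linearl q : linear (fun p => qbr p q).
Proof.
move=> c x y; rewrite -[x]qreprK -[y]qreprK -[q]qreprK -linearP !qbr_qpi.
by rewrite brDl brZl linearP.
Qed.
Lemma qbr_linearr p : linear (qbr p).
Proof.
by move=> c x y; rewrite -[x]qreprK -[y]qreprK -[p]qreprK -linearP !qbr_qpi !linearP.
Qed.
HB.instance Definition _ := hasBracket.Build K (quotm I) qbr_linearl qbr_linearr.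

Lemma qpi_br x y : qpi I ⁅x, y⁆ = ⁅qpi I x, qpi I y⁆.
Proof. by rewrite -qbr_qpi. Qed.
End QuotientAlgebra.

Section QuotientLeibniz.
Variables (K : fieldType) (L : leibnizType K) (I : brIdeal L).

Lemma quotm_leibniz (x y z : quotm I) : ⁅x, ⁅y, z⁆⁆ = ⁅⁅x, y⁆, z⁆ - ⁅⁅x, z⁆, y⁆.
Proof.
by rewrite -[x]qreprK -[y]qreprK -[z]qreprK -!qpi_br leibniz linearB.
Qed.
HB.instance Definition _ := isLeibniz.Build K (quotm I) quotm_leibniz.
End QuotientLeibniz.

Inductive mtree (X : Type) : Type :=
| MLeaf of X
| MNode of mtree X & mtree X.

HB.instance Definition _ (X : Type) := gen_eqMixin (mtree X).
HB.instance Definition _ (X : Type) := gen_choiceMixin (mtree X).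

(** The free (non-associative) algebra on [X]: its basis is the free magma. *)
Section FreeAlgebra.
Variables (K : fieldType) (X : Type).

Definition freeAlg : Type := freeMod K (mtree X).
HB.instance Definition _ := GRing.Lmodule.on freeAlg.

Definition fbr (u v : freeAlg) : freeAlg :=
  fmlift (fun s => fmlift (fun t => fm K (MNode s t)) v) u.

Lemma fbr_linearl v : linear (fun u => fbr u v).
Proof. exact: fmlift_linear. Qed.

Lemma fbr_fml s v : fbr (fm K s) v = fmlift (fun t => fm K (MNode s t)) v.
Proof. exact: fmlift_fm. Qed.

Lemma fbr_linearr u : linear (fbr u).
Proof.
move=> c v w.
have fbr0 z : fbr 0 z = 0 by exact: raddf0.
elim/fm_ind: u => [|k s u IH]; first by rewrite !fbr0 scaler0 addr0.
rewrite !fbr_linearl IH !fbr_fml linearP !scalerDr !scalerA [k * c]mulrC.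
by rewrite addrACA.
Qed.
HB.instance Definition _ := hasBracket.Build K freeAlg fbr_linearl fbr_linearr.

Definition fgen (x : X) : freeAlg := fm K (MLeaf x).

Lemma br_fm s t : ⁅fm K s : freeAlg, fm K t⁆ = fm K (MNode s t).
Proof. by rewrite -[LHS]/(fbr _ _) fbr_fml fmlift_fm. Qed.

Variables (A : brAlgType K) (f : X -> A).

Fixpoint tree_eval (t : mtree X) : A :=
  match t with
  | MLeaf x => f x
  | MNode s t => ⁅tree_eval s, tree_eval t⁆
  end.

Definition free_lift (u : freeAlg) : A := fmlift tree_eval u.
HB.instance Definition _ :=
  GRing.isLinear.Build K freeAlg A *:%R free_lift (fmlift_linear tree_eval).

Lemma free_lift_gen x : free_lift (fgen x) = f x.
Proof. exact: fmlift_fm. Qed.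

Lemma free_liftP : linear free_lift. Proof. exact: fmlift_linear. Qed.
Lemma free_liftN u : free_lift (- u) = - free_lift u. Proof. exact: linearN. Qed.
Lemma free_liftB u v : free_lift (u - v) = free_lift u - free_lift v.
Proof. exact: linearB. Qed.

Lemma free_lift_br : {morph free_lift : u v / ⁅u, v⁆}.
Proof.
move=> u v.
elim/fm_ind: u => [|c s u IH]; first by rewrite br0l linear0 br0l.
rewrite brDl brZl !free_liftP IH brDl brZl; congr (_ *: _ + _).
elim/fm_ind: v {u IH} => [|k t v IH]; first by rewrite !linear0.
rewrite br_linearr !free_liftP IH br_linearr; congr (_ *: _ + _).
by rewrite br_fm /free_lift !fmlift_fm.
Qed.
End FreeAlgebra.

Section Presentation.
Variables (K : fieldType) (X : Type) (R : freeAlg K X -> freeAlg K X -> Prop).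

Inductive pres_rel : freeAlg K X -> freeAlg K X -> Prop :=
| pres_leibniz u v w : pres_rel ⁅u, ⁅v, w⁆⁆ (⁅⁅u, v⁆, w⁆ - ⁅⁅u, w⁆, v⁆)
| pres_given u v : R u v -> pres_rel u v.

Definition presLeib : Type := quotm (gen_ideal pres_rel).
HB.instance Definition _ := BrAlgebra.on presLeib.

Definition ppi (u : freeAlg K X) : presLeib := qpi (gen_ideal pres_rel) u.

Lemma ppi_surj x : exists u, x = ppi u.
Proof. by exists (qrepr x); rewrite -[LHS]qreprK. Qed.
Lemma ppi_linear : linear ppi. Proof. exact: linearP. Qed.
Lemma ppiB u v : ppi (u - v) = ppi u - ppi v. Proof. exact: linearB. Qed.
Lemma ppi_br u v : ppi ⁅u, v⁆ = ⁅ppi u, ppi v⁆. Proof. exact: qpi_br. Qed.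

Lemma ppi_rel u v : pres_rel u v -> ppi u = ppi v.
Proof. by move=> h; apply/eq_qpi/asboolP; exact: gi_gen. Qed.

Lemma presLeib_leibniz (x y z : presLeib) :
  ⁅x, ⁅y, z⁆⁆ = ⁅⁅x, y⁆, z⁆ - ⁅⁅x, z⁆, y⁆.
Proof.
have [u ->] := ppi_surj x; have [v ->] := ppi_surj y; have [w ->] := ppi_surj z.
rewrite -!ppi_br -ppiB; exact: (ppi_rel (pres_leibniz _ _ _)).
Qed.
HB.instance Definition _ := isLeibniz.Build K presLeib presLeib_leibniz.

Definition pgen (x : X) : presLeib := ppi (fgen K x).

Variables (L : leibnizType K) (f : X -> L).
Hypothesis fR : forall u v, R u v -> free_lift f u = free_lift f v.

Lemma pres_lift_subproof x : x \in gen_ideal pres_rel -> free_lift f x = 0.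
Proof.
apply: gen_ideal_sub; first exact: free_lift_br.
move=> _ _ [u v w|u v]; last exact: fR.
rewrite -[LHS]/(free_lift f _) -[RHS]/(free_lift f _) free_liftB.
by rewrite !free_lift_br leibniz.
Qed.

Definition pres_lift : presLeib -> L := qlift (free_lift f).
Lemma pres_lift_linear : linear pres_lift.
Proof. exact: (qlift_linear pres_lift_subproof). Qed.

Lemma pres_lift_ppi u : pres_lift (ppi u) = free_lift f u.
Proof. exact: (qlift_qpi pres_lift_subproof). Qed.

Lemma pres_lift_gen x : pres_lift (pgen x) = f x.
Proof. by rewrite pres_lift_ppi free_lift_gen. Qed.

Lemma pres_lift_br : {morph pres_lift : p q / ⁅p, q⁆}.
Proof.
move=> p q; have [u ->] := ppi_surj p; have [v ->] := ppi_surj q.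
by rewrite -ppi_br !pres_lift_ppi free_lift_br.
Qed.
End Presentation.

Section NonAbelianTensor.
Variables (K : fieldType) (g : leibnizType K) (A B : brIdeal g).

Inductive star_gen : Type :=
| StarGen1 of subm A & subm B
| StarGen2 of subm B & subm A.

Local Notation "a *1 b" := (fgen K (StarGen1 a b)) (at level 40).
Local Notation "b *2 a" := (fgen K (StarGen2 b a)) (at level 40).

(* [A] and [B] are ideals, so for [a] in [A] and [b] in [B] the brackets [a,b]
   and [b,a] are elements of both; the index tells which one is meant. *)
Local Notation "[A a , y ]" := (ibrr a (val y)) (a at level 9, y at level 9).
Local Notation "[A' y , a ]" := (ibrl (val y) a) (y at level 9, a at level 9).
Local Notation "[B b , y ]" := (ibrr b (val y)) (b at level 9, y at level 9).
Local Notation "[B' y , b ]" := (ibrl (val y) b) (y at level 9, b at level 9).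

Implicit Types (a : subm A) (b : subm B) (c : K).

Inductive star_rel : freeAlg K star_gen -> freeAlg K star_gen -> Prop :=
| star_lin1l c a a' b : star_rel ((c *: a + a') *1 b) (c *: (a *1 b) + a' *1 b)
| star_lin1r c a b b' : star_rel (a *1 (c *: b + b')) (c *: (a *1 b) + a *1 b')
| star_lin2l c b b' a : star_rel ((c *: b + b') *2 a) (c *: (b *2 a) + b' *2 a)
| star_lin2r c b a a' : star_rel (b *2 (c *: a + a')) (c *: (b *2 a) + b *2 a')
| star_1 a b b' :
    star_rel (a *1 [B b, b']) ([A a, b] *1 b' - [A a, b'] *1 b)
| star_2 b a a' :
    star_rel (b *2 [A a, a']) ([B b, a] *2 a' - [B b, a'] *2 a)
| star_3 a a' b :
    star_rel ([A a, a'] *1 b) ([B' a, b] *2 a' - a *1 [B b, a'])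
| star_4 b b' a :
    star_rel ([B b, b'] *2 a) ([A' b, a] *1 b' - b *2 [A a, b'])
| star_5 a a' b : star_rel (a *1 [B' a', b]) (- (a *1 [B b, a']))
| star_6 b b' a : star_rel (b *2 [A' b', a]) (- (b *2 [A a, b']))
| star_7l a b a' b' :
    star_rel ([A a, b] *1 [B' a', b']) ⁅a *1 b, a' *1 b'⁆
| star_7r a b a' b' :
    star_rel ⁅a *1 b, a' *1 b'⁆ ([B' a, b] *2 [A a', b'])
| star_8l a b a' b' :
    star_rel ([A' b, a] *1 [B b', a']) ⁅b *2 a, b' *2 a'⁆
| star_8r a b a' b' :
    star_rel ⁅b *2 a, b' *2 a'⁆ ([B b, a] *2 [A' b', a'])
| star_9l a b a' b' :
    star_rel ([A a, b] *1 [B b', a']) ⁅a *1 b, b' *2 a'⁆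
| star_9r a b a' b' :
    star_rel ⁅a *1 b, b' *2 a'⁆ ([B' a, b] *2 [A' b', a'])
| star_10l a b a' b' :
    star_rel ([A' b, a] *1 [B' a', b']) ⁅b *2 a, a' *1 b'⁆
| star_10r a b a' b' :
    star_rel ⁅b *2 a, a' *1 b'⁆ ([B b, a] *2 [A a', b']).

Definition star : leibnizType K := presLeib star_rel.
Definition star1 a b : star := pgen star_rel (StarGen1 a b).
Definition star2 b a : star := pgen star_rel (StarGen2 b a).

(* The linear span of the differences [star1 c d' - star2 d c'] below is already
   an ideal: by [star_7l] to [star_10r] these differences are central.
   [c] and [d] are one element of the intersection of [A] and [B], seen in [A]
   and in [B] respectively; likewise [c'] and [d']. *)
Inductive wedge_rel : star -> star -> Prop :=
| wedge_cap (c c' : subm A) (d d' : subm B) :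
    val c = val d -> val c' = val d' -> wedge_rel (star1 c d') (star2 d c').

Definition wedge : leibnizType K := quotm (gen_ideal wedge_rel).
Definition wpi (u : star) : wedge := qpi (gen_ideal wedge_rel) u.
Definition wedge1 a b : wedge := wpi (star1 a b).
Definition wedge2 b a : wedge := wpi (star2 b a).

Definition theta_gen (s : star_gen) : g :=
  match s with
  | StarGen1 a b => ⁅val a, val b⁆
  | StarGen2 b a => ⁅val b, val a⁆
  end.

Lemma theta_gen_rel u v :
  star_rel u v -> free_lift theta_gen u = free_lift theta_gen v.
Proof.
case=> *; rewrite ?free_liftP ?free_liftB ?free_liftN ?free_lift_br
  ?free_lift_gen /= ?free_lift_gen /=.
all: by rewrite ?brDl ?brZl ?br_linearr // ?leibniz // opprB // addrC subrK.
Qed.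

Definition star_theta : star -> g := pres_lift theta_gen.
HB.instance Definition _ := GRing.isLinear.Build K star g *:%R star_theta
  (pres_lift_linear theta_gen_rel).

Lemma star_theta_wedge u : u \in gen_ideal wedge_rel -> star_theta u = 0.
Proof.
apply: gen_ideal_sub; first exact: (pres_lift_br theta_gen_rel).
move=> _ _ [c c' d d' e e']; rewrite /= /star_theta.
by rewrite !(pres_lift_gen theta_gen_rel) /= e e'.
Qed.

(** [theta] is valued in the intersection of [A] and [B] ([theta_cap]); we keep
    [g] as its formal codomain, which does not change its kernel. *)
Definition theta : wedge -> g := qlift star_theta.
HB.instance Definition _ :=
  GRing.isLinear.Build K wedge g *:%R theta (qlift_linear star_theta_wedge).

Lemma theta_wedge1 a b : theta (wedge1 a b) = ⁅val a, val b⁆.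
Proof.
by rewrite /theta (qlift_qpi star_theta_wedge) /= /star_theta
  (pres_lift_gen theta_gen_rel).
Qed.

Lemma theta_wedge2 b a : theta (wedge2 b a) = ⁅val b, val a⁆.
Proof.
by rewrite /theta (qlift_qpi star_theta_wedge) /= /star_theta
  (pres_lift_gen theta_gen_rel).
Qed.

Lemma theta_br : {morph theta : u v / ⁅u, v⁆}.
Proof.
move=> p q; rewrite -[p]qreprK -[q]qreprK; move: (qrepr p) (qrepr q) => u v.
rewrite -qpi_br /theta.
rewrite !(qlift_qpi star_theta_wedge); exact: (pres_lift_br theta_gen_rel).
Qed.

Lemma theta_cap u : (theta u \in A) && (theta u \in B).
Proof.
have cap_gen (s : star_gen) : (theta_gen s \in A) && (theta_gen s \in B).
  case: s => [a b|b a] /=; apply/andP; split;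
  by [apply: ideal_brr; exact: valP | apply: ideal_brl; exact: valP].
rewrite -[u]qreprK /theta (qlift_qpi star_theta_wedge).
have [w ->] := ppi_surj (qrepr u).
rewrite /= /star_theta (pres_lift_ppi theta_gen_rel).
elim/fm_ind: w => [|c t w /andP[hA hB]].
  by rewrite linear0 !rpred0.
rewrite free_liftP; set x := free_lift _ _.
have [tA tB] : x \in A /\ x \in B.
  rewrite {}/x /free_lift fmlift_fm; elim: t => [s|t1 IH1 t2 _] /=; last case: IH1 => A1 B1.
    exact/andP.
  by split; apply: ideal_brr.
by rewrite !rpredD ?rpredZ.
Qed.

End NonAbelianTensor.
Arguments star {K g} A B.
Arguments wedge {K g} A B.
Arguments theta {K g} A B u.

Section TensorPower.
Variables (K : fieldType) (V : lmodType K) (n : nat).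

Definition upd (k : 'I_n) (w : V) (x : {ffun 'I_n -> V}) : {ffun 'I_n -> V} :=
  [ffun i => if i == k then w else x i].

Definition multilinear (W : lmodType K) (f : {ffun 'I_n -> V} -> W) : Prop :=
  forall k c u v x,
    f (upd k (c *: u + v) x) = c *: f (upd k u x) + f (upd k v x).

Inductive tpow_rel : freeMod K {ffun 'I_n -> V} -> Prop :=
| tpow_lin k c u v x :
    tpow_rel (fm K (upd k (c *: u + v) x)
              - (c *: fm K (upd k u x) + fm K (upd k v x))).

Definition tpow : lmodType K := quotm (span tpow_rel).
Definition tens (x : {ffun 'I_n -> V}) : tpow := qpi (span tpow_rel) (fm K x).

Lemma tens_multilinear : multilinear tens.
Proof.
move=> k c u v x; rewrite /tens -linearP; apply/eq_qpi/asboolP/span_gen.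
exact: tpow_lin.
Qed.

Variables (W : lmodType K) (f : {ffun 'I_n -> V} -> W).
Hypothesis fM : multilinear f.

Lemma tpow_lift_subproof u : u \in span tpow_rel -> fmlift f u = 0.
Proof.
apply: span_sub => _ [k c v w x].
rewrite -[LHS]/(fmlift f _) fmliftB fmlift_linear.
by rewrite !fmlift_fm fM subrr.
Qed.

Definition tpow_lift : tpow -> W := qlift (fmlift f).
Lemma tpow_lift_linear : linear tpow_lift.
Proof. exact: (qlift_linear tpow_lift_subproof). Qed.

Lemma tpow_lift_tens x : tpow_lift (tens x) = f x.
Proof. exact: etrans (qlift_qpi tpow_lift_subproof _) (fmlift_fm f x). Qed.
End TensorPower.

Section LeibnizHomology.
Variables (K : fieldType) (g : leibnizType K).

Definition CL (n : nat) : lmodType K := tpow g n.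

(* Remove entry [j] and replace entry [i] by the bracket of entries [i], [j]. *)
Definition face n (i j : 'I_n) (x : {ffun 'I_n -> g}) : {ffun 'I_n.-1 -> g} :=
  [ffun k => if lift j k == i then ⁅x i, x j⁆ else x (lift j k)].

(* The sign is [(-1) ^+ j.+1] since indices start from 0 here. *)
Definition dtens n (x : {ffun 'I_n -> g}) : CL n.-1 :=
  \sum_(j < n) \sum_(i < n | (i < j)%N) (-1) ^+ j.+1 *: tens (face i j x).

Lemma face_upd n (i j : 'I_n) (k' : 'I_n.-1) w x :
  i != j -> lift j k' != i ->
  face i j (upd (lift j k') w x) = upd k' w (face i j x).
Proof.
move=> ij ki; apply/ffunP => l; rewrite !ffunE.
rewrite (inj_eq lift_inj) [i == _]eq_sym (negPf ki) (negPf (neq_lift _ _)).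
by case: (l =P k') => [->|//]; rewrite (negPf ki).
Qed.

Lemma face_upd_l n (i j : 'I_n) (i' : 'I_n.-1) w x : i = lift j i' ->
  face i j (upd i w x) = upd i' ⁅w, x j⁆ (face i j x).
Proof.
move=> ->; apply/ffunP => l; rewrite !ffunE eqxx (negPf (neq_lift _ _)).
by rewrite (inj_eq lift_inj); case: eqP.
Qed.

Lemma face_upd_r n (i j : 'I_n) (i' : 'I_n.-1) w x : i = lift j i' ->
  face i j (upd j w x) = upd i' ⁅x i, w⁆ (face i j x).
Proof.
move=> ->; apply/ffunP => l; rewrite !ffunE eqxx !(inj_eq lift_inj).
by rewrite ![lift j _ == j]eq_sym !(negPf (neq_lift _ _)); case: eqP.
Qed.

Lemma tens_face_multilinear n (i j : 'I_n) : i != j ->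
  multilinear (fun x => tens (face i j x)).
Proof.
move=> ij k c u v x.
have [i' ei] : exists i', i = lift j i'.
  by case: (unliftP j i) => [i' ->|ei]; [exists i'|rewrite ei eqxx in ij].
case: (unliftP j k) => [k' ek|->].
- case: (eqVneq k i) => [->|ki].
    by rewrite !(face_upd_l _ _ ei) brDl brZl tens_multilinear.
  by rewrite ek !face_upd -?ek // tens_multilinear.
- by rewrite !(face_upd_r _ _ ei) linearP tens_multilinear.
Qed.

Lemma dtens_multilinear n : multilinear (@dtens n).
Proof.
move=> k c u v x; rewrite /dtens scaler_sumr -big_split /=.
apply: eq_bigr => j _; rewrite scaler_sumr -big_split /=.
apply: eq_bigr => i ij; rewrite tens_face_multilinear; last first.
  by apply: contraTneq ij => ->; rewrite ltnn.
by rewrite scalerDr !scalerA [c * _]mulrC.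
Qed.

Definition dCL (n : nat) : CL n -> CL n.-1 := tpow_lift (@dtens n).
HB.instance Definition _ n := GRing.isLinear.Build K (CL n) (CL n.-1) *:%R (@dCL n)
  (tpow_lift_linear (@dtens_multilinear n)).

Lemma dCL_tens n x : dCL (tens x) = @dtens n x.
Proof. exact: (tpow_lift_tens (@dtens_multilinear n)). Qed.

(* [dCL 0] and [dCL 1] are zero: the sums defining them are empty. *)
Definition HL (n : nat) : lmodType K := homology (@dCL n.+1) (@dCL n).

End LeibnizHomology.

(* Main.v *)
(** In [g ⋏ g] the symbols [x *_1 y] and [x *_2 y] coincide, and besides
    bilinearity the relations amount to [x ⋏ [y,z] = [x,y] ⋏ z - [x,z] ⋏ y],
    i.e. the vanishing of the Leibniz differential of [x⊗y⊗z], together with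
    [[p,q] = θ p ⋏ θ q].
    Conversely [coker d_3] is a Leibniz algebra under [[p,q] = d p ⊗ d q], so
    the presentation gives an inverse to [coker d_3 -> g ⋏ g].  This isomorphism
    carries [d_2] to [θ], hence [ker d_2 / im d_3] to [ker θ]. *)
Require Import Defs.
From HB Require Import structures.
From mathcomp Require Import all_boot all_algebra.
From mathcomp Require Import boolp.

Set Implicit Arguments.
Unset Strict Implicit.
Unset Printing Implicit Defensive.

Import GRing.Theory.
Local Open Scope ring_scope.

(** * Tensor powers of degree at most three *)

Section TensorPowers.
Variables (K : fieldType) (V : lmodType K).

Lemma tens_ind n (P : tpow V n -> Prop) :
  P 0 -> (forall c x t, P t -> P (c *: tens x + t)) -> forall t, P t.
Proof.
move=> P0 PD t; rewrite -[t]qreprK; elim/fm_ind: (qrepr t) => [|c x u IH].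
  by rewrite linear0.
by rewrite linearP; exact: PD.
Qed.

Lemma tpow_linear_ext n (W : lmodType K) (f h : {linear tpow V n -> W}) :
  (forall x, f (tens x) = h (tens x)) -> f =1 h.
Proof.
move=> fh; elim/tens_ind => [|c x t IH]; first by rewrite !linear0.
by rewrite !linearP fh IH.
Qed.

(** The default [0] is never read below, where [s] always has length [n]. *)
Definition vec n (s : seq V) : {ffun 'I_n -> V} := [ffun i : 'I_n => nth 0 s i].

Lemma vec1E (x : {ffun 'I_1 -> V}) : x = vec 1 [:: x ord0].
Proof. by apply/ffunP => i; rewrite ffunE ord1. Qed.

Lemma vec2E (x : {ffun 'I_2 -> V}) : x = vec 2 [:: x ord0; x ord_max].
Proof.
by apply/ffunP => -[[|[|//]] lt_i]; rewrite ffunE /=; congr (x _); exact: val_inj.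
Qed.

Lemma vec3E (x : {ffun 'I_3 -> V}) :
  x = vec 3 [:: x ord0; x (inord 1); x ord_max].
Proof.
apply/ffunP => -[[|[|[|//]]] lt_i]; rewrite ffunE /=; congr (x _);
  by apply: val_inj; rewrite //= inordK.
Qed.

Lemma multilinear2 (W : lmodType K) (h : V -> V -> W) :
    (forall y, linear (h^~ y)) -> (forall x, linear (h x)) ->
  multilinear (fun x : {ffun 'I_2 -> V} => h (x ord0) (x ord_max)).
Proof.
move=> hl hr -[[|[|//]] lt_k] c u v x; rewrite !ffunE /=.
  exact: hl.
exact: hr.
Qed.

Lemma tens2_linearl y : linear (fun x => tens (vec 2 [:: x; y])).
Proof.
move=> c u v.
(* The filler [0] is overwritten by [upd]; any vector would do. *)
have e w : vec 2 [:: w; y] = upd ord0 w (vec 2 [:: 0; y]).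
  by apply/ffunP => -[[|[|//]] lt_i]; rewrite !ffunE.
by rewrite (e (_ + _)) (e u) (e v) tens_multilinear.
Qed.

Lemma tens2_linearr x : linear (fun y => tens (vec 2 [:: x; y])).
Proof.
move=> c u v.
have e w : vec 2 [:: x; w] = upd ord_max w (vec 2 [:: x; 0]).
  by apply/ffunP => -[[|[|//]] lt_i]; rewrite !ffunE.
by rewrite (e (_ + _)) (e u) (e v) tens_multilinear.
Qed.

(** The canonical isomorphism from [V] to its first tensor power, with inverse [tpow1_val]. *)
Definition tens1 (x : V) : tpow V 1 := tens (vec 1 [:: x]).

Lemma tens1_linear : linear tens1.
Proof.
move=> c u v.
have e w : vec 1 [:: w] = upd ord0 w (vec 1 [:: 0]).
  by apply/ffunP => i; rewrite !ffunE ord1.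
by rewrite /tens1 (e (_ + _)) (e u) (e v) tens_multilinear.
Qed.
HB.instance Definition _ :=
  GRing.isLinear.Build K V (tpow V 1) *:%R tens1 tens1_linear.

Lemma multilinear_eval1 :
  multilinear (fun x : {ffun 'I_1 -> V} => x ord0).
Proof. by move=> k c u v x; rewrite [k]ord1 !ffunE eqxx. Qed.

Definition tpow1_val : tpow V 1 -> V :=
  tpow_lift (fun x : {ffun 'I_1 -> V} => x ord0).
HB.instance Definition _ := GRing.isLinear.Build K (tpow V 1) V *:%R tpow1_val
  (tpow_lift_linear multilinear_eval1).

Lemma tens1K : cancel tens1 tpow1_val.
Proof. by move=> x; rewrite /tpow1_val /tens1 (tpow_lift_tens multilinear_eval1) ffunE. Qed.

Lemma tpow1_valK : cancel tpow1_val tens1.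
Proof.
apply: (tpow_linear_ext (f := tens1 \o tpow1_val) (h := idfun)) => x /=.
by rewrite [x]vec1E -/(tens1 _) tens1K.
Qed.

End TensorPowers.

Section SecondHomology.
Variables (K : fieldType) (g : leibnizType K).

(** * The Leibniz differential in degrees two and three *)

Lemma dCL2_tens (x y : g) :
  dCL (tens (vec 2 [:: x; y])) = tens1 ⁅x, y⁆.
Proof.
rewrite dCL_tens /dtens; under eq_bigr do rewrite big_mkcond.
rewrite !big_ord_recl !big_ord0 /= ?addr0 ?add0r.
rewrite sqrrN expr1n scale1r /tens1; congr (tens _). apply/ffunP => k.
by rewrite [k]ord1 !ffunE.
Qed.

Lemma dCL3_tens (x y z : g) : dCL (tens (vec 3 [:: x; y; z])) =
  tens (vec 2 [:: ⁅x, y⁆; z])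
  - tens (vec 2 [:: ⁅x, z⁆; y]) - tens (vec 2 [:: x; ⁅y, z⁆]).
Proof.
(* With [i < j] moved into the summand, both sums can be written out; the pairs (0,1), (0,2), (1,2)
   survive, with signs +, -, -. *)
rewrite dCL_tens /dtens; under eq_bigr do rewrite big_mkcond.
rewrite !big_ord_recl !big_ord0 /= ?addr0 ?add0r.
rewrite sqrrN expr1n scale1r /bump /= !addn0 exprS sqrrN expr1n mulr1 !scaleN1r addrA.
by congr (tens _ - tens _ - tens _); apply/ffunP => -[[|[|//]] lt_k]; rewrite !ffunE.
Qed.

(** The differential $d_2$ made [g]-valued, so that it can be compared with [theta]. *)
Definition CL2_br (t : CL g 2) : g := tpow1_val (dCL t).

Lemma CL2_br_linear : linear CL2_br.
Proof. by move=> c s t; rewrite /CL2_br !linearP. Qed.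
HB.instance Definition _ :=
  GRing.isLinear.Build K (CL g 2) g *:%R CL2_br CL2_br_linear.

Lemma CL2_br_tens x y : CL2_br (tens (vec 2 [:: x; y])) = ⁅x, y⁆.
Proof. by rewrite /CL2_br dCL2_tens tens1K. Qed.

Lemma CL2_br_eq0 t : (CL2_br t == 0) = (dCL t == 0).
Proof. by rewrite /CL2_br (can2_eq (@tpow1_valK _ g) (@tens1K _ g)) linear0. Qed.

(** On a pure tensor this is the Leibniz identity. *)
Lemma CL2_br_dCL (t : CL g 3) : CL2_br (dCL t) = 0.
Proof.
elim/tens_ind: t => [|c x t IH]; first by rewrite !linear0.
rewrite linearP CL2_br_linear IH addr0 [x]vec3E /= dCL3_tens !linearB /=.
by rewrite !CL2_br_tens leibniz -!scalerBr subrr scaler0.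
Qed.

Lemma CL2_br_boundary t : t \in iml (@dCL K g 3) -> CL2_br t = 0.
Proof. by move=> /asboolP[u <-]; exact: CL2_br_dCL. Qed.

(** * The cokernel of $d_3$ as a Leibniz algebra *)

Definition CL2_coker : Type := quotm (iml (@dCL K g 3)).
HB.instance Definition _ := GRing.Lmodule.on CL2_coker.

Definition cpi (t : CL g 2) : CL2_coker := qpi (iml (@dCL K g 3)) t.
Lemma cpi_linear : linear cpi. Proof. exact: linearP. Qed.
HB.instance Definition _ :=
  GRing.isLinear.Build K (CL g 2) CL2_coker *:%R cpi cpi_linear.

Definition cten (x y : g) : CL2_coker := cpi (tens (vec 2 [:: x; y])).

Lemma cten_linearl y : linear (cten^~ y).
Proof. by move=> c u v; rewrite /cten tens2_linearl linearP. Qed.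

Lemma cten_linearr x : linear (cten x).
Proof. by move=> c u v; rewrite /cten tens2_linearr linearP. Qed.

(** The boundary of $x\otimes y\otimes z$ vanishes in the cokernel. *)
Lemma cten_brr x y z : cten x ⁅y, z⁆ = cten ⁅x, y⁆ z - cten ⁅x, z⁆ y.
Proof.
have: cpi (dCL (tens (vec 3 [:: x; y; z]))) = 0.
  by apply/qpi_eq0/asboolP; exists (tens (vec 3 [:: x; y; z])).
by rewrite dCL3_tens !linearB => /eqP; rewrite subr_eq0 => /eqP.
Qed.

Definition coker_br : CL2_coker -> g := qlift CL2_br.
HB.instance Definition _ :=
  GRing.isLinear.Build K CL2_coker g *:%R coker_br (qlift_linear CL2_br_boundary).

Lemma coker_br_cten x y : coker_br (cten x y) = ⁅x, y⁆.
Proof. by rewrite /coker_br (qlift_qpi CL2_br_boundary) /= CL2_br_tens. Qed.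

Definition cbr (p q : CL2_coker) : CL2_coker := cten (coker_br p) (coker_br q).

Lemma cbr_linearl q : linear (cbr^~ q).
Proof. by move=> c u v; rewrite /cbr linearP cten_linearl. Qed.
Lemma cbr_linearr p : linear (cbr p).
Proof. by move=> c u v; rewrite /cbr linearP cten_linearr. Qed.
HB.instance Definition _ := hasBracket.Build K CL2_coker cbr_linearl cbr_linearr.

Lemma cbrE (p q : CL2_coker) : ⁅p, q⁆ = cten (coker_br p) (coker_br q).
Proof. by []. Qed.

(** As [coker_br] sends [cten x y] to the bracket of [x] and [y], this is [cten_brr] at the images
    of the three elements under [coker_br]. *)
Lemma cbr_leibniz (x y z : CL2_coker) : ⁅x, ⁅y, z⁆⁆ = ⁅⁅x, y⁆, z⁆ - ⁅⁅x, z⁆, y⁆.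
Proof. by rewrite !cbrE !coker_br_cten cten_brr. Qed.
HB.instance Definition _ := isLeibniz.Build K CL2_coker cbr_leibniz.

(** * Relations in the exterior square of [g] *)

Local Notation G := (full_ideal g).

Definition full (x : g) : subm G := @Subm K g G x isT.

Lemma full_val x : full (val x) = x. Proof. exact: val_inj. Qed.

Definition wg (x y : g) : wedge G G := wedge1 (full x) (full y).

(** Both ideals are all of [g], so [wedge_cap] applies to every pair and merges the two families of
    symbols. *)
Lemma wedge2E x y : wedge2 x y = wg (val x) (val y).
Proof. by apply/esym/eq_qpi/asboolP/gi_gen; exact: wedge_cap. Qed.

Lemma wedge1E x y : wedge1 x y = wg (val x) (val y).
Proof. by rewrite /wg !full_val. Qed.

Lemma wpi_linear : linear (wpi (A := G) (B := G)).
Proof. exact: linearP. Qed.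

Lemma wpi_br (p q : star G G) : wpi ⁅p, q⁆ = ⁅wpi p, wpi q⁆.
Proof. exact: qpi_br. Qed.

Lemma wpi_rel u v : star_rel (A := G) (B := G) u v ->
  wpi (ppi (star_rel (A := G) (B := G)) u) = wpi (ppi _ v).
Proof. by move=> h; congr wpi; apply/ppi_rel/pres_given. Qed.

Lemma wg_linearl y : linear (wg^~ y).
Proof.
move=> c u v; have := wpi_rel (star_lin1l c (full u) (full v) (full y)).
rewrite ppi_linear wpi_linear /wg /wedge1 /star1 /pgen => <-.
(* The two elements of [subm G] have the same underlying vector. *)
by congr (wpi (ppi _ (fgen _ (StarGen1 _ _)))); exact: val_inj.
Qed.

Lemma wg_linearr x : linear (wg x).
Proof.
move=> c u v; have := wpi_rel (star_lin1r c (full x) (full u) (full v)).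
rewrite ppi_linear wpi_linear /wg /wedge1 /star1 /pgen => <-.
by congr (wpi (ppi _ (fgen _ (StarGen1 _ _)))); exact: val_inj.
Qed.

Lemma wg_brr x y z : wg x ⁅y, z⁆ = wg ⁅x, y⁆ z - wg ⁅x, z⁆ y.
Proof.
have := wpi_rel (star_1 (full x) (full y) (full z)).
rewrite ppiB [wpi (_ - _)]linearB -!/(pgen _ _) -!/(star1 _ _) -!/(wedge1 _ _).
by rewrite !wedge1E.
Qed.

Lemma br_wg x y x' y' : ⁅wg x y, wg x' y'⁆ = wg ⁅x, y⁆ ⁅x', y'⁆.
Proof.
have := wpi_rel (star_7l (full x) (full y) (full x') (full y')).
rewrite ppi_br wpi_br -!/(pgen _ _) -!/(star1 _ _) -!/(wedge1 _ _).
by rewrite !wedge1E.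
Qed.

Lemma theta_wg x y : theta G G (wg x y) = ⁅x, y⁆.
Proof. exact: theta_wedge1. Qed.

(** * The surjection from 2-chains onto the exterior square *)

Definition CL2_wedge : CL g 2 -> wedge G G :=
  tpow_lift (fun x : {ffun 'I_2 -> g} => wg (x ord0) (x ord_max)).
Lemma CL2_wedge_linear : linear CL2_wedge.
Proof. exact: (tpow_lift_linear (multilinear2 wg_linearl wg_linearr)). Qed.
HB.instance Definition _ := GRing.isLinear.Build K (CL g 2) (wedge G G) *:%R
  CL2_wedge CL2_wedge_linear.

Lemma CL2_wedge_tens x y : CL2_wedge (tens (vec 2 [:: x; y])) = wg x y.
Proof.
rewrite /CL2_wedge (tpow_lift_tens (multilinear2 wg_linearl wg_linearr)).
by rewrite !ffunE.
Qed.

Lemma theta_CL2_wedge t : theta G G (CL2_wedge t) = CL2_br t.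
Proof.
elim/tens_ind: t => [|c x t IH]; first by rewrite !linear0.
by rewrite !linearP /= IH [x]vec2E CL2_wedge_tens theta_wg CL2_br_tens.
Qed.

(** On a pure tensor this is [wg_brr]. *)
Lemma CL2_wedge_dCL (t : CL g 3) : CL2_wedge (dCL t) = 0.
Proof.
elim/tens_ind: t => [|c x t IH]; first by rewrite !linear0.
rewrite linearP CL2_wedge_linear IH addr0 [x]vec3E /= dCL3_tens !linearB /=.
by rewrite !CL2_wedge_tens wg_brr -!scalerBr subrr scaler0.
Qed.

(** Both sides are bilinear in [s] and [t], which reduces the claim to [br_wg]. It shows that a
    bracket of two images is a single wedge. *)
Lemma br_CL2_wedge s t :
  ⁅CL2_wedge s, CL2_wedge t⁆ = wg (CL2_br s) (CL2_br t).
Proof.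
(* Linearity at scalar -1 and zero vectors reads [wg 0 y = - wg 0 y + wg 0 y]. *)
have wg0l y : wg 0 y = 0.
  by move: (wg_linearl y (-1) 0 0); rewrite scaler0 addr0 scaleN1r addNr.
have wg0r x : wg x 0 = 0.
  by move: (wg_linearr x (-1) 0 0); rewrite scaler0 addr0 scaleN1r addNr.
elim/tens_ind: s => [|c x s IH]; first by rewrite !linear0 br0l wg0l.
rewrite CL2_wedge_linear CL2_br_linear brDl brZl wg_linearl IH.
congr (_ *: _ + _); elim/tens_ind: t {s IH} => [|k y t IH].
  by rewrite !linear0 wg0r.
rewrite CL2_wedge_linear CL2_br_linear br_linearr wg_linearr IH.
by rewrite [x]vec2E [y]vec2E !CL2_wedge_tens !CL2_br_tens br_wg.
Qed.

(** Wedges generate only as an algebra, but brackets of wedges are wedges again; hence an induction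
    on the bracket trees of the free algebra. *)
Lemma CL2_wedge_surj w : exists t, CL2_wedge t = w.
Proof.
rewrite -[w]qreprK; have [u ->] := ppi_surj (qrepr w).
elim/fm_ind: u => [|c s u [t IH]].
  by exists 0; rewrite -[RHS]/(qpi _ (qpi _ 0)) !linear0.
suff [t' ht'] : exists t', CL2_wedge t' = wpi (ppi _ (fm K s)).
  exists (c *: t' + t); rewrite CL2_wedge_linear ppi_linear IH ht'.
  by rewrite linearP.
elim: s => [[a b|b a]|s1 [t1 IH1] s2 [t2 IH2]].
- exists (tens (vec 2 [:: val a; val b])).
  by rewrite CL2_wedge_tens -wedge1E.
- exists (tens (vec 2 [:: val b; val a])).
  by rewrite CL2_wedge_tens -wedge2E.
- exists (tens (vec 2 [:: CL2_br t1; CL2_br t2])).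
  by rewrite CL2_wedge_tens -br_CL2_wedge IH1 IH2 -wpi_br -ppi_br br_fm.
Qed.

(** * The inverse map, from the exterior square to the cokernel *)

Definition coker_gen (s : star_gen G G) : CL2_coker :=
  match s with
  | StarGen1 a b => cten (val a) (val b)
  | StarGen2 b a => cten (val b) (val a)
  end.

Lemma coker_gen_rel u v :
  star_rel u v -> free_lift coker_gen u = free_lift coker_gen v.
Proof.
case=> *; rewrite ?free_liftP ?free_liftB ?free_liftN ?free_lift_br
  ?free_lift_gen /= ?free_lift_gen /=.
(* This settles bilinearity and the relations [star_7l] to [star_10r], which match the definition of
   the bracket; the others follow by expanding with [cten_brr]. *)
all: rewrite ?cbrE ?coker_br_cten ?cten_linearl ?cten_linearr //.
all: by rewrite ?cten_brr // opprB // addrC subrK.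
Qed.

Definition star_coker : star G G -> CL2_coker := pres_lift coker_gen.
HB.instance Definition _ := GRing.isLinear.Build K (star G G) CL2_coker *:%R
  star_coker (pres_lift_linear coker_gen_rel).

(** [coker_gen] sends both kinds of symbol to the same tensor. *)
Lemma star_coker_wedge u : u \in gen_ideal (wedge_rel (A := G) (B := G)) ->
  star_coker u = 0.
Proof.
apply: gen_ideal_sub; first exact: (pres_lift_br coker_gen_rel).
move=> _ _ [c c' d d' e e']; rewrite /= /star_coker.
by rewrite !(pres_lift_gen coker_gen_rel) /= e e'.
Qed.

Definition wedge_coker : wedge G G -> CL2_coker := qlift star_coker.
HB.instance Definition _ := GRing.isLinear.Build K (wedge G G) CL2_coker *:%R
  wedge_coker (qlift_linear star_coker_wedge).

Lemma wedge_coker_wg x y : wedge_coker (wg x y) = cten x y.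
Proof.
by rewrite /wedge_coker (qlift_qpi star_coker_wedge) /= /star_coker
  (pres_lift_gen coker_gen_rel).
Qed.

Lemma CL2_wedgeK t : wedge_coker (CL2_wedge t) = cpi t.
Proof.
elim/tens_ind: t => [|c x t IH]; first by rewrite !linear0.
by rewrite !linearP /= IH [x]vec2E CL2_wedge_tens wedge_coker_wg.
Qed.

(** By [CL2_wedgeK], the class of [t] in the cokernel can be recovered from its wedge. *)
Lemma CL2_wedge_eq0 t : CL2_wedge t = 0 <-> t \in iml (@dCL K g 3).
Proof.
split=> [t0|/asboolP[u <-]]; last exact: CL2_wedge_dCL.
by apply/qpi_eq0; rewrite -[LHS]CL2_wedgeK t0 linear0.
Qed.

(** * Restriction to cycles and passage to homology *)

Lemma CL2_wedge_ker (z : subm (kerl (@dCL K g 2))) :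
  CL2_wedge (val z) \in kerl (theta G G).
Proof.
suff: CL2_br (val z) == 0 by rewrite -theta_CL2_wedge.
by rewrite CL2_br_eq0; exact: valP z.
Qed.

Definition cycle_wedge z : subm (kerl (theta G G)) := Subm (CL2_wedge_ker z).

Lemma cycle_wedge_linear : linear cycle_wedge.
Proof. by move=> c y z; apply: val_inj; rewrite /= !linearP. Qed.
HB.instance Definition _ := GRing.isLinear.Build K (subm (kerl (@dCL K g 2)))
  (subm (kerl (theta G G))) *:%R cycle_wedge cycle_wedge_linear.

Lemma cycle_wedge_eq0 z :
  cycle_wedge z = 0 <-> z \in @boundaries _ _ _ _ (@dCL K g 3) (@dCL K g 2).
Proof.
rewrite -[_ \in _]/(val z \in iml (@dCL K g 3)) -CL2_wedge_eq0.
by split=> [/(congr1 val)|z0] //; apply: val_inj.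
Qed.

(** Any preimage of [w] under [CL2_wedge] is a cycle, because [theta] composed with [CL2_wedge] is
    [CL2_br]. *)
Lemma cycle_wedge_surj w : exists z, cycle_wedge z = w.
Proof.
have [t tw] := CL2_wedge_surj (val w).
have t_cycle : t \in kerl (@dCL K g 2).
  suff: dCL t == 0 by [].
  by rewrite -CL2_br_eq0 -theta_CL2_wedge tw; exact: valP w.
by exists (Subm t_cycle); apply: val_inj.
Qed.

Definition HL2_wedge : HL g 2 -> subm (kerl (theta G G)) := qlift cycle_wedge.

Lemma boundary_cycle_wedge z :
  z \in @boundaries _ _ _ _ (@dCL K g 3) (@dCL K g 2) -> cycle_wedge z = 0.
Proof. by move/cycle_wedge_eq0. Qed.
HB.instance Definition _ := GRing.isLinear.Build K (HL g 2)
  (subm (kerl (theta G G))) *:%R HL2_wedge (qlift_linear boundary_cycle_wedge).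

Lemma HL2_wedge_qpi z :
  HL2_wedge (qpi (@boundaries _ _ _ _ (@dCL K g 3) (@dCL K g 2)) z)
  = cycle_wedge z.
Proof. exact: (qlift_qpi boundary_cycle_wedge z). Qed.

End SecondHomology.

Theorem theorem3p16 (K : fieldType) (g : leibnizType K) :
  exists f : {linear HL g 2 -> subm (kerl (theta (full_ideal g) (full_ideal g)))},
    bijective f.
Proof.
exists (@HL2_wedge K g).
have surj (w : subm (kerl (theta (full_ideal g) (full_ideal g)))) :
   exists q, HL2_wedge q = w.
  have [z <-] := cycle_wedge_surj w.
  by eexists; exact: HL2_wedge_qpi z.
have inj : injective (@HL2_wedge K g).
  apply: raddf_inj => q; rewrite -[q]qreprK /=.
  rewrite HL2_wedge_qpi.
  by move/cycle_wedge_eq0/qpi_eq0.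
(* Choice gives a right inverse, which injectivity makes two-sided. *)
have [h hK] := choice surj.
by exists h => // q; apply: inj; rewrite hK.
Qed.
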